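(* The family of finite graphs with VC-dimension $\leq 1$ has the Erdős–Hajnal property; that is, there exists a real number $\epsilon>0$ such that every finite graph $G$ of VC-dimension $\leq 1$ has a clique or an anti-clique of size $\geq |G|^{\epsilon}$.
   Context: A graph $G=(V,E)$ is a vertex set $V$ with a symmetric anti-reflexive binary relation $E$ on $V$; $|G|$ denotes $|V|$. A clique is a set of pairwise adjacent vertices, and an anti-clique is a set of pairwise non-adjacent vertices. For $d\in\mathbb{N}$, a graph $G=(V,E)$ is of VC-dimension $<d$ if there is no $d$-tuple $(x_0,\dots,x_{d-1})$ of pairwise distinct vertices of $V$ such that for every $\epsilon\in\{0,1\}^d$ there is $a_\epsilon\in V$ such that for all $i<d$: $E(a_\epsilon,x_i)$ holds if and only if $\epsilon(i)=1$. VC-dimension $\leq d$ means VC-dimension $<d+1$. A family of finite graphs has the Erdős–Hajnal property if there is $\epsilon>0$ such that every graph $G$ in the family has a clique or an anti-clique of size $\geq |G|^\epsilon$. *)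

(* Defs.v *)
From HB Require Import structures.
From mathcomp Require Import all_boot all_order all_algebra.
From mathcomp Require Import reals exp.

Set Implicit Arguments.
Unset Strict Implicit.
Unset Printing Implicit Defensive.

Import Order.TTheory GRing.Theory Num.Theory.
Local Open Scope ring_scope.

Record fin_graph := FinGraph {
  vertex :> finType;
  adj : rel vertex;
  adj_sym : symmetric adj;
  adj_irr : irreflexive adj }.

Section Graph.
Variable G : fin_graph.

Definition clique (A : {set G}) : Prop :=
  {in A &, forall x y, x != y -> adj x y}.

Definition anticlique (A : {set G}) : Prop :=
  {in A &, forall x y, x != y -> ~~ adj x y}.

(* The witness a may be any vertex, including one of the x_i. *)
Definition shattered (d : nat) (x : d.-tuple G) : Prop :=
  forall e : d.-tuple bool, exists a : G,
    forall i : 'I_d, adj a (tnth x i) = tnth e i.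

Definition VCdim_lt (d : nat) : Prop :=
  ~ exists x : d.-tuple G, uniq x /\ shattered x.

Definition VCdim_le (d : nat) : Prop := VCdim_lt d.+1.

End Graph.

(* The exponent does not depend on the graph. For the empty graph the bound
   is trivial, since 0 `^ eps = 0 when eps != 0. *)
Definition erdos_hajnal (R : realType) (F : fin_graph -> Prop) : Prop :=
  exists eps : R, 0 < eps /\
    forall G : fin_graph, F G ->
      exists A : {set G}, (clique A \/ anticlique A) /\
        #|G|%:R `^ eps <= #|A|%:R.

(* Main.v *)
(** If [x] and [y] are non-adjacent neighbours of [v], then [v] is adjacent to
    both and [x] to neither, so VC-dimension at most 1 forces their
    neighbourhoods to be nested; conversely, vertices with nested
    neighbourhoods are non-adjacent.  Hence on [N(v)] non-adjacency is
    comparability of neighbourhoods, and Mirsky's theorem applies: when all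
    cliques and anticliques have size at most [k], so that the cliques inside
    [N(v)] have size at most [k - 1], every degree is at most [k * (k - 1)].
    The closed neighbourhoods of a largest anticlique cover [G], which gives
    [|G| <= k * (k * (k - 1) + 1) <= k ^ 3] and the exponent 1/3. *)

Require Import Defs.
From mathcomp Require Import all_boot all_order all_algebra.
From mathcomp Require Import boolp reals exp.

Set Implicit Arguments.
Unset Strict Implicit.
Unset Printing Implicit Defensive.

Import Order.TTheory GRing.Theory Num.Theory.

Lemma card_bigcup_le (I T : finType) (P : pred I) (F : I -> {set T}) :
  #|\bigcup_(i | P i) F i| <= \sum_(i | P i) #|F i|.
Proof.
elim/big_ind2: _ => [|A m B n Am Bn|//]; first by rewrite cards0.
by apply: leq_trans (leq_add Am Bn); rewrite cardsU leq_subr.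
Qed.

Section Mirsky.
Variables (T : finType) (lt : rel T).
Hypotheses (lt_irr : irreflexive lt) (lt_trans : transitive lt).

(** The height [h x], the size of a largest chain in [S] with top element [x], strictly increases
    along [lt]. Its fibres are therefore antichains, of size at most [b], and it takes at most [a]
    values on [S]. *)
Lemma card_le_chain_antichain (S : {set T}) (a b : nat) :
  (forall C : {set T}, C \subset S ->
    {in C &, forall x y, x != y -> lt x y || lt y x} -> #|C| <= a) ->
  (forall A : {set T}, A \subset S ->
    {in A &, forall x y, ~~ lt x y} -> #|A| <= b) ->
  #|S| <= a * b.
Proof.
move=> chain_le antichain_le.
pose topped x (C : {set T}) :=
  [&& C \subset S, x \in C, [forall y in C, (y == x) || lt y x] &
    [forall y in C, forall z in C, (y != z) ==> (lt y z || lt z y)]].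
pose h x := \max_(C | topped x C) #|C|.
have h_le x : h x <= a.
  apply/bigmax_leqP => C /and4P[CS _ _ /forall_inP chC].
  by apply: chain_le => // y z yC zC; apply/implyP/(forall_inP (chC y yC)).
have topped1 x : x \in S -> topped x [set x].
  move=> xS; rewrite /topped sub1set xS set11 /=.
  apply/andP; split; first by apply/forall_inP => y /set1P ->; rewrite eqxx.
  by apply/forall_inP => y /set1P ->; apply/forall_inP => z /set1P ->; rewrite eqxx.
have h_gt0 x : x \in S -> 0 < h x.
  move=> xS; rewrite -(cards1 x).
  exact: (@leq_bigmax_cond _ (topped x) (fun C => #|C|) _ (topped1 x xS)).
have h_lt x y : x \in S -> y \in S -> lt x y -> h x < h y.
  move=> xS yS xy.
  (* A largest chain [C] topped by [x] lies entirely below [y], so [y |: C] is a longer chain topped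
     by [y]. *)
  have [|C tC hE] := @eq_bigmax_cond _ (topped x) (fun C => #|C|).
    by apply/card_gt0P; exists [set x]; apply: topped1.
  case/and4P: tC => CS xC /forall_inP topC /forall_inP chC.
  have Cy z : z \in C -> lt z y.
    by move=> zC; case/orP: (topC z zC) => [/eqP -> //|/lt_trans]; apply.
  have yC : y \notin C by apply/negP => /Cy; rewrite lt_irr.
  rewrite [h x]hE -[_.+1]add1n -[1]/(nat_of_bool true) -yC -cardsU1.
  apply: (@leq_bigmax_cond _ (topped y) (fun C => #|C|)).
  apply/and4P; split; first by rewrite subUset sub1set yS.
  - exact: setU11.
  - by apply/forall_inP => z /setU1P[->|/Cy ->]; rewrite ?eqxx ?orbT.
  - apply/forall_inP => z /setU1P[->|zC]; apply/forall_inP => w /setU1P[->|wC].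
    + by rewrite eqxx.
    + by rewrite (Cy w wC) orbT implybT.
    + by rewrite (Cy z zC) implybT.
    + exact: (forall_inP (chC z zC)).
(* Heights on [S] start at 1, so the shift [i.+1] leaves exactly [a] fibres. *)
have S_fibers : S \subset \bigcup_(i < a) [set x in S | h x == i.+1].
  apply/subsetP => x xS; have hx := prednK (h_gt0 x xS).
  have xa : (h x).-1 < a by rewrite hx.
  by apply/bigcupP; exists (Ordinal xa) => //; rewrite inE xS /= hx.
apply: leq_trans (subset_leq_card S_fibers) _.
apply: leq_trans (card_bigcup_le _ _) _.
rewrite -[a in a * b]card_ord -sum_nat_const; apply: leq_sum => i _.
apply: antichain_le => [|x y]; first by apply/subsetP => x; rewrite inE => /andP[].
rewrite !inE => /andP[xS /eqP hx] /andP[yS /eqP hy].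
by apply/negP => /(h_lt _ _ xS yS); rewrite hx hy ltnn.
Qed.

End Mirsky.

Section Graph.
Variable G : fin_graph.

Definition nbhd (x : G) : {set G} := [set y | adj x y].

(** The vertices [p], [q], [r], [s] realise the patterns 11, 10, 01, 00, so the pair would be
    shattered. *)
Lemma VCdim_le1_pair (x y p q r s : G) : VCdim_le G 1 -> x != y ->
  adj p x && adj p y -> adj q x && ~~ adj q y ->
  ~~ adj r x && adj r y -> ~~ adj s x && ~~ adj s y -> False.
Proof.
move=> vc xy /andP[px py] /andP[qx qy] /andP[rx ry] /andP[sx sy].
apply: vc; exists [tuple x; y]; split; first by rewrite /= inE xy.
move=> e; exists (if tnth e ord0 then if tnth e ord_max then p else q
                  else if tnth e ord_max then r else s).
move=> i; have [->|->] : i = ord0 \/ i = ord_max.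
  by case: i => [[|[|//]] ?]; [left|right]; apply: val_inj.
all: rewrite [tnth [tuple _; _] _]/=.
all: by case: (tnth e ord0); case: (tnth e ord_max) => //; apply: negbTE.
Qed.

Lemma nbhd_nested (v x y : G) : VCdim_le G 1 -> x \in nbhd v -> y \in nbhd v ->
  ~~ adj x y -> (nbhd x \subset nbhd y) || (nbhd y \subset nbhd x).
Proof.
rewrite !inE => vc vx vy nxy.
have [-> | xy] := eqVneq x y; first by rewrite subxx.
apply: contraT; rewrite negb_or => /andP[].
move=> /subsetPn[q]; rewrite !inE => xq yq /subsetPn[r]; rewrite !inE => yr xr.
case: (@VCdim_le1_pair x y v q r x vc xy).
- by rewrite vx.
- by rewrite !(adj_sym q) xq.
- by rewrite !(adj_sym r) yr andbT.
- by rewrite adj_irr.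
Qed.

(** An edge would put [y] in [nbhd x], hence in [nbhd y], against irreflexivity. *)
Lemma nbhd_sub_nadj (x y : G) : nbhd x \subset nbhd y -> ~~ adj x y.
Proof.
by move=> /subsetP/(_ y); rewrite !inE adj_irr; case: (adj x y) => // /(_ isT).
Qed.

(* Inclusion of neighbourhoods is only a preorder; equal neighbourhoods are
   ordered by the enumeration of the vertices. *)
Definition nbhd_lt (x y : G) : bool :=
  (nbhd x \subset nbhd y) &&
  ((nbhd y \subset nbhd x) ==> (enum_rank x < enum_rank y)).

Lemma nbhd_lt_irr : irreflexive nbhd_lt.
Proof. by move=> x; rewrite /nbhd_lt subxx ltnn. Qed.

Lemma nbhd_lt_trans : transitive nbhd_lt.
Proof.
move=> y x z /andP[xy /implyP rxy] /andP[yz /implyP ryz].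
rewrite /nbhd_lt (subset_trans xy yz); apply/implyP => zx.
exact: ltn_trans (rxy (subset_trans yz zx)) (ryz (subset_trans zx xy)).
Qed.

Lemma nbhd_lt_total (x y : G) : x != y ->
  (nbhd x \subset nbhd y) || (nbhd y \subset nbhd x) ->
  nbhd_lt x y || nbhd_lt y x.
Proof.
rewrite /nbhd_lt -(inj_eq enum_rank_inj) -val_eqE neq_ltn /=.
by case: (nbhd x \subset _); case: (nbhd y \subset _).
Qed.

Section Bounded.
Variable k : nat.
Hypothesis vc : VCdim_le G 1.
Hypothesis hom_le : forall A : {set G}, clique A \/ anticlique A -> #|A| <= k.

Lemma degree_le (v : G) : #|nbhd v| <= k * k.-1.
Proof.
apply: (card_le_chain_antichain nbhd_lt_irr nbhd_lt_trans) => [C _ chC|A AN acA].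
  apply: hom_le; right=> x y xC yC xy.
  case/orP: (chC x y xC yC xy) => /andP[/nbhd_sub_nadj nadj _] //.
  by rewrite adj_sym.
have vA : v \notin A by apply/negP => /(subsetP AN); rewrite inE adj_irr.
(* Adding [v] to the clique [A] inside its neighbourhood gains one vertex, whence [k.-1] rather than
   [k]. *)
suff /hom_le : clique (v |: A) \/ anticlique (v |: A).
  by rewrite cardsU1 vA; case: k.
have vadj x : x \in A -> adj v x by move=> /(subsetP AN); rewrite inE.
left=> x y /setU1P[->|xA] /setU1P[->|yA] xy; first by rewrite eqxx in xy.
- exact: vadj.
- by rewrite adj_sym vadj.
apply: contraT => nxy.
have := nbhd_lt_total xy
  (nbhd_nested vc (subsetP AN x xA) (subsetP AN y yA) nxy).
by rewrite (negbTE (acA x y xA yA)) (negbTE (acA y x yA xA)).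
Qed.

Lemma card_le_hom_cube : #|G| <= k ^ 3.
Proof.
have anticlique0 : `[< anticlique (set0 : {set G}) >].
  by apply/asboolP => x y; rewrite inE.
case: (@arg_maxnP _ set0 (fun I => `[< anticlique I >]) (fun I => #|I|) anticlique0).
move=> I /asboolP acI maxI.
have cover : [set: G] \subset \bigcup_(v in I) (v |: nbhd v).
  apply/subsetP => x _; apply: contraT => xI.
  have nx v : v \in I -> (x != v) && ~~ adj v x.
    move=> vI; apply: contraR xI; rewrite negb_and !negbK => xv.
    by apply/bigcupP; exists v => //; rewrite !inE.
  have xnI : x \notin I by apply/negP => /nx; rewrite eqxx.
  (* An uncovered [x] would extend the largest anticlique. *)
  have /asboolP/maxI : anticlique (x |: I).
    move=> y z /setU1P[->|yI] /setU1P[->|zI]; first by rewrite eqxx.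
    - by rewrite adj_sym; case/andP: (nx z zI).
    - by case/andP: (nx y yI).
    - exact: acI.
  by rewrite /= cardsU1 xnI ltnn.
have Ik : #|I| <= k by apply: hom_le; right.
have sumI : #|G| <= \sum_(v in I) #|v |: nbhd v|.
  rewrite -cardsT; apply: leq_trans (subset_leq_card cover) _.
  exact: card_bigcup_le.
apply: leq_trans sumI _.
apply: (@leq_trans (\sum_(v in I) (k * k.-1).+1)).
  apply: leq_sum => v _; rewrite cardsU1 -add1n leq_add ?degree_le //.
  by case: (_ \notin _).
rewrite sum_nat_const.
(* If [k] is 0, then [I] is empty; otherwise [k * k.-1 + 1 <= k ^ 2]. *)
case: k Ik => [|m] Im; first by rewrite leqn0 in Im; rewrite (eqP Im).
rewrite expnS leq_mul //= expnS expn1 mulnS.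
by rewrite -add1n leq_add.
Qed.

End Bounded.
End Graph.

Local Open Scope ring_scope.

Theorem theorem1p1 (R : realType) :
  erdos_hajnal R (fun G : fin_graph => VCdim_le G 1).
Proof.
exists 3^-1; split=> [|G vc]; first by rewrite invr_gt0.
have hom0 : `[< clique (set0 : {set G}) \/ anticlique (set0 : {set G}) >].
  by apply/asboolP; left=> x y; rewrite inE.
case: (@arg_maxnP _ set0 (fun A => `[< clique A \/ anticlique A >]) (fun A => #|A|) hom0).
move=> A /asboolP homA maxA; exists A; split=> //.
have le3 : (#|G| <= #|A| ^ 3)%N.
  by apply: card_le_hom_cube => // B homB; apply/maxA/asboolP.
(* Writing the size of [A] as the cube root of its cube reduces the bound to monotonicity of the
   power function. *)
have -> : #|A|%:R = ((#|A| ^ 3)%:R `^ 3^-1 :> R).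
  by rewrite natrX -powR_mulrn // -powRrM divff ?powRr1 // pnatr_eq0.
by apply: ge0_ler_powR; rewrite ?nnegrE ?ler_nat ?invr_ge0.
Qed.
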